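(* Let $n\ge 3$. For $m\ge 2$ order the $2$-subsets $\{s,t\}$, $s<t$, of $\{1,\dots,m\}$ lexicographically and use them to index the coordinates of $\mathbb{F}_q^{\binom m2}$; thus the first $n-1$ coordinates of $\mathbb{F}_q^{\binom n2}$ are indexed by $\{1,2\},\dots,\{1,n\}$ and the remaining $\binom{n-1}{2}$ by the $2$-subsets of $\{2,\dots,n\}$, which we identify with the $2$-subsets of $\{1,\dots,n-1\}$ via $i\mapsto i-1$, so that $\mathbb{F}_q^{\binom n2}=\mathbb{F}_q^{n-1}\times\mathbb{F}_q^{\binom{n-1}{2}}$. For $v,u\in\mathbb{F}_q^m$ let $X_{v,u}\in\mathbb{F}_q^{\binom m2}$ have $\{s,t\}$-coordinate $v_su_t-v_tu_s$. For a $2$-subspace $U$ of $\mathbb{F}_q^m$ with basis $u,w$ let $P(U)=\langle X_{u,w}\rangle$, and for a $1$-subspace $V$ of $\mathbb{F}_q^m$ let $P_V=\bigcup_{U}P(U)$, the union over all $2$-subspaces $U\supseteq V$. Let $\mathbb{C}_n=\{P_V : V\in\mathcal{G}_q(n,1)\}$. Define $\mathbb{D}\subseteq\mathcal{P}(\mathbb{F}_q^{\binom n2})$ to consist of: $U_0=\{(x,\mathbf{0}):x\in\mathbb{F}_q^{n-1}\}$; for every nonzero $\hat v\in\mathbb{F}_q^{n-1}$, the subspace $U_{\hat v,0}=\langle\{(\hat v,\mathbf{0})\}\cup\{(\mathbf{0},w):w\in P_{\langle\hat v\rangle}\}\rangle$; and for every nonzero $\hat v\in\mathbb{F}_q^{n-1}$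 and nonzero $a\in\mathbb{F}_q$, the row span $U_{\hat v,a}$ of the $(n-1)\times\binom n2$ matrix whose $i$-th row is $(\hat e_i,\,a X_{\hat v,\hat e_i})$, $i=1,\dots,n-1$, where $\hat e_i$ is the $i$-th unit vector of $\mathbb{F}_q^{n-1}$. Then $\mathbb{D}=\mathbb{C}_n$.
   Context: $\mathcal{G}_q(m,k)$ is the set of $k$-dimensional subspaces of $\mathbb{F}_q^m$; $\langle S\rangle$ is the linear span; $\mathcal{P}(\cdot)$ denotes the set of subspaces. $P(U)$ is the (projective) Plücker embedding of the $2$-subspace $U$, viewed as a $1$-subspace of $\mathbb{F}_q^{\binom m2}$; it does not depend on the chosen basis. *)

(* Defs.v *)
From mathcomp Require Import all_boot all_order all_algebra.
From mathcomp Require Import boolp classical_sets.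
From mathcomp Require Import ring.

Set Implicit Arguments.
Unset Strict Implicit.
Unset Printing Implicit Defensive.

Import GRing.Theory.
Local Open Scope classical_set_scope.
Local Open Scope ring_scope.

Definition lex_pairs_seq (m : nat) : seq ('I_m * 'I_m) :=
  [seq (s, t) | s : 'I_m <- enum 'I_m,
                t <- [seq t : 'I_m <- enum 'I_m | (s < t)%N]].

(* The lexicographically first pairs are (0, t), followed by the shifted pairs
   of 'I_m: this is what lets join below stand for the identification of
   F^(n-1) x F^'C(n-1, 2) with F^'C(n, 2). *)
Lemma lex_pairs_seqS (m : nat) :
  lex_pairs_seq m.+1 =
    [seq (ord0, lift ord0 t) | t <- enum 'I_m] ++
    [seq (lift ord0 st.1, lift ord0 st.2) | st <- lex_pairs_seq m].
Proof.
rewrite /lex_pairs_seq enum_ordSl /= filter_map -map_comp; congr (_ ++ _).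
  by rewrite (eq_filter (a2 := predT)) ?filter_predT.
rewrite map_allpairs allpairs_mapl; congr flatten; apply: eq_map => s.
by rewrite filter_map -map_comp.
Qed.

Lemma size_lex_pairs (m : nat) : size (lex_pairs_seq m) == 'C(m, 2).
Proof.
elim: m => [|m /eqP IH]; first by rewrite /lex_pairs_seq enum_ord0.
by rewrite lex_pairs_seqS size_cat 2!size_map size_enum_ord IH binS bin1 addnC.
Qed.

(* Coordinate k of 'rV_'C(m, 2) is indexed by the pair tnth (lex_pairs m) k. *)
Definition lex_pairs (m : nat) : 'C(m, 2).-tuple ('I_m * 'I_m) :=
  Tuple (size_lex_pairs m).

Lemma coord_splitE (n : nat) : (n.-1 + 'C(n.-1, 2) = 'C(n, 2))%N.
Proof. by case: n => [|n] //=; rewrite binS bin1 addnC. Qed.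

Definition join (F : finFieldType) (n : nat)
    (x : 'rV[F]_n.-1) (y : 'rV[F]_('C(n.-1, 2))) : 'rV[F]_('C(n, 2)) :=
  castmx (erefl 1%N, coord_splitE n) (row_mx x y).

Definition Xvec (F : finFieldType) (m : nat) (v u : 'rV[F]_m) :
    'rV[F]_('C(m, 2)) :=
  \row_k (let st := tnth (lex_pairs m) k in
          v 0 st.1 * u 0 st.2 - v 0 st.2 * u 0 st.1).

Definition grassmannian (F : finFieldType) (m k : nat) : set {vspace 'rV[F]_m} :=
  [set U | \dim U = k].
Arguments grassmannian : clear implicits.

(* P(U), computed on the canonical basis of U; see pluckerE. *)
Definition plucker (F : finFieldType) (m : nat) (U : {vspace 'rV[F]_m}) :
    {vspace 'rV[F]_('C(m, 2))} :=
  <[Xvec (vbasis U)`_0 (vbasis U)`_1]>%VS.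

Lemma Xvec_comb (F : finFieldType) (m : nat) (u w : 'rV[F]_m) (a b c d : F) :
  Xvec (a *: u + b *: w) (c *: u + d *: w) = (a * d - b * c) *: Xvec u w.
Proof.
by apply/rowP => k; rewrite !mxE /= !mxE; ring.
Qed.

Lemma pluckerE (F : finFieldType) (m : nat) (U : {vspace 'rV[F]_m})
    (u w : 'rV[F]_m) :
  basis_of U [:: u; w] -> plucker U = <[Xvec u w]>%VS.
Proof.
have sub (x y x' y' : 'rV[F]_m) : basis_of U [:: x; y] ->
    basis_of U [:: x'; y'] -> (<[Xvec x y]> <= <[Xvec x' y']>)%VS.
  move=> Bxy Bxy'.
  have dec z : z \in [:: x; y] -> exists a b, z = a *: x' + b *: y'.
    move=> /(basis_mem Bxy); rewrite -(span_basis Bxy') span_cons span_seq1.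
    by case/memv_addP => _ /vlineP[a ->] [_ /vlineP[b ->] ->]; exists a, b.
  have [a [b ->]] := dec x (mem_head _ _).
  have [c [d ->]] := dec y (mem_last x [:: y]).
  by rewrite Xvec_comb -memvE memvZ ?memv_line.
move=> Buw; have dU : \dim U = 2%N by exact: (size_basis (X := [tuple u; w])).
have BU : basis_of U [:: (vbasis U)`_0; (vbasis U)`_1].
  have := vbasisP U; have : size (vbasis U) = 2%N by rewrite size_tuple.
  by case: (tval (vbasis U)) => [|x [|y []]].
by apply/eqP; rewrite eqEsubv; apply/andP; split; apply: sub.
Qed.

Definition PV (F : finFieldType) (m : nat) (V : {vspace 'rV[F]_m}) :
    set 'rV[F]_('C(m, 2)) :=
  \bigcup_(U in [set U : {vspace 'rV[F]_m} | grassmannian F m 2 U /\ (V <= U)%VS])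
    [set` plucker U].

Definition CC (F : finFieldType) (n : nat) : set (set 'rV[F]_('C(n, 2))) :=
  [set PV V | V in grassmannian F n 1].
Arguments CC : clear implicits.

Definition linspan (F : finFieldType) (N : nat) (A : set 'rV[F]_N) :
    {vspace 'rV[F]_N} :=
  <<[seq x <- enum 'rV[F]_N | x \in A]>>%VS.

Lemma linspan_sub (F : finFieldType) (N : nat) (A : set 'rV[F]_N)
    (U : {vspace 'rV[F]_N}) :
  (linspan A <= U)%VS <-> A `<=` [set` U].
Proof.
split=> [/span_subvP sAU x Ax /=|sAU].
  by apply: sAU; rewrite mem_filter; apply/andP; split; [exact/mem_set | rewrite mem_enum].
by apply/span_subvP => x; rewrite mem_filter => /andP[/set_mem/sAU].
Qed.

Definition rowspan (F : finFieldType) (p N : nat) (M : 'M[F]_(p, N)) :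
    set 'rV[F]_N :=
  [set x | (x <= M)%MS].

Definition U_zero (F : finFieldType) (n : nat) : set 'rV[F]_('C(n, 2)) :=
  [set join x 0 | x in [set: 'rV[F]_n.-1]].
Arguments U_zero : clear implicits.

Definition U_vec0 (F : finFieldType) (n : nat) (v : 'rV[F]_n.-1) :
    set 'rV[F]_('C(n, 2)) :=
  [set` linspan ([set join v 0] `|` [set join 0 w | w in PV <[v]>%VS])].

Definition U_vec (F : finFieldType) (n : nat) (v : 'rV[F]_n.-1) (a : F) :
    set 'rV[F]_('C(n, 2)) :=
  rowspan (\matrix_(i < n.-1)
             join (delta_mx 0 i) (a *: Xvec v (delta_mx 0 i))).

Definition DD (F : finFieldType) (n : nat) : set (set 'rV[F]_('C(n, 2))) :=
  [set A | [\/ A = U_zero F n,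
               (exists2 v : 'rV[F]_n.-1, v != 0 & A = U_vec0 v) |
               (exists v : 'rV[F]_n.-1, exists a : F,
                  [/\ v != 0, a != 0 & A = U_vec v a])]].
Arguments DD : clear implicits.

Lemma DD_subspace (F : finFieldType) (n : nat) (A : set 'rV[F]_('C(n, 2))) :
  DD F n A -> exists U : {vspace 'rV[F]_('C(n, 2))}, A = [set` U].
Proof.
have sub0 (B : set 'rV[F]_('C(n, 2))) :
    B 0 -> (forall a x y, B x -> B y -> B (a *: x + y)) ->
    exists U : {vspace 'rV[F]_('C(n, 2))}, B = [set` U].
  move=> B0 BD; exists (linspan B); apply/seteqP; split; first exact/linspan_sub.
  rewrite /linspan; set s := [seq _ <- _ | _] => x /=.
  move=> /(coord_span (X := in_tuple s)) ->.
  apply: (big_rec B) => // i y _ By; apply: BD => //.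
  by have := mem_nth 0 (ltn_ord i); rewrite mem_filter => /andP[/set_mem].
case=> [->|[v _ ->]|[v [a [_ _ ->]]]].
- apply: sub0; first by exists 0 => //; rewrite /join row_mx0 castmx_const.
  move=> a _ _ [x _ <-] [y _ <-]; exists (a *: x + y) => //.
  rewrite /join; case: _ / (coord_splitE n); rewrite !castmx_id.
  by rewrite scale_row_mx add_row_mx scaler0 addr0.
- by eexists; reflexivity.
- apply: sub0; first exact: sub0mx.
  by move=> b x y sx sy; apply/addmx_sub/sy/scalemx_sub.
Qed.

(* Main.v *)
(* For a nonzero v the set P_<v> is the image of the linear map u |-> X_{v,u}.
   Writing v = (a, v') and u = (b, u') with a, b in F, one has
   X_{v,u} = (a u' - b v', X_{v',u'}).  The families U_0, U_{v',0} and U_{v',a}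
   are the images obtained when v' = 0, when a = 0, and when neither vanishes;
   in the last case the substitution x = a u' - b v' turns X_{v',u'} into
   a^-1 X_{v',x}, since X_{v',v'} = 0. *)
Require Import Defs.
From HB Require Import structures.
From mathcomp Require Import all_boot all_order all_algebra.
From mathcomp Require Import boolp classical_sets.
From mathcomp Require Import ring.

Set Implicit Arguments.
Unset Strict Implicit.
Unset Printing Implicit Defensive.

Import GRing.Theory.
Local Open Scope classical_set_scope.
Local Open Scope ring_scope.

Section Plucker.
Variable F : finFieldType.

Lemma Xvec_is_linear (m : nat) (v : 'rV[F]_m) : linear (Xvec v).
Proof. by move=> c x y; apply/rowP => k; rewrite !mxE /= !mxE; ring. Qed.

HB.instance Definition _ (m : nat) (v : 'rV[F]_m) :=
  GRing.isLinear.Build F 'rV[F]_m 'rV[F]_('C(m, 2)) *:%R (Xvec v)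
    (Xvec_is_linear v).

Lemma XvecZl (m : nat) (c : F) (v u : 'rV[F]_m) :
  Xvec (c *: v) u = c *: Xvec v u.
Proof. by apply/rowP => k; rewrite !mxE /= !mxE; ring. Qed.

Lemma Xvecvv (m : nat) (v : 'rV[F]_m) : Xvec v v = 0.
Proof. by apply/rowP => k; rewrite !mxE /=; ring. Qed.

Lemma Xvec0l (m : nat) (u : 'rV[F]_m) : Xvec 0 u = 0.
Proof. by rewrite -(scale0r 0) XvecZl scale0r. Qed.

Lemma join_linear (n : nat) (c : F) (x x' : 'rV[F]_n.-1)
    (y y' : 'rV[F]_('C(n.-1, 2))) :
  join (c *: x + x') (c *: y + y') = c *: join x y + join x' y'.
Proof.
rewrite /join; case: _ / (coord_splitE n); rewrite !castmx_id.
by rewrite scale_row_mx add_row_mx.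
Qed.

Lemma joinD (n : nat) (x x' : 'rV[F]_n.-1) (y y' : 'rV[F]_('C(n.-1, 2))) :
  join (x + x') (y + y') = join x y + join x' y'.
Proof. by rewrite -[x]scale1r -[y]scale1r join_linear !scale1r. Qed.

Lemma join0 (n : nat) : join 0 0 = 0 :> 'rV[F]_('C(n, 2)).
Proof. by rewrite /join row_mx0 castmx_const. Qed.

Lemma joinZ (n : nat) (c : F) (x : 'rV[F]_n.-1) (y : 'rV[F]_('C(n.-1, 2))) :
  join (c *: x) (c *: y) = c *: join x y.
Proof. by rewrite -[c *: x]addr0 -[c *: y]addr0 join_linear join0 addr0. Qed.

(** Indexing by [unlift ord0] matches the [lift ord0] in [lex_pairs_seqS]. *)
Definition cons_row (m : nat) (a : F) (v : 'rV[F]_m) : 'rV[F]_m.+1 :=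
  \row_i oapp (v 0) a (unlift ord0 i).

Lemma cons_row_ord0 (m : nat) (a : F) (v : 'rV[F]_m) : cons_row a v 0 ord0 = a.
Proof. by rewrite mxE unlift_none. Qed.

Lemma cons_row_lift (m : nat) (a : F) (v : 'rV[F]_m) (i : 'I_m) :
  cons_row a v 0 (lift ord0 i) = v 0 i.
Proof. by rewrite mxE liftK. Qed.

Lemma cons_rowK (m : nat) (w : 'rV[F]_m.+1) :
  cons_row (w 0 ord0) (\row_i w 0 (lift ord0 i)) = w.
Proof.
apply/rowP => i; case: (unliftP ord0 i) => [j|] ->.
  by rewrite cons_row_lift mxE.
by rewrite cons_row_ord0.
Qed.

Lemma cons_row_eq0 (m : nat) (a : F) (v : 'rV[F]_m) :
  (cons_row a v == 0) = (a == 0) && (v == 0).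
Proof.
apply/eqP/andP => [E|[/eqP-> /eqP->]].
  split; apply/eqP; first by rewrite -(cons_row_ord0 a v) E mxE.
  by apply/rowP => i; rewrite -(cons_row_lift a v) E !mxE.
by apply/rowP => i; case: (unliftP ord0 i) => [j|] ->;
  rewrite ?cons_row_lift ?cons_row_ord0 !mxE.
Qed.

(** By [lex_pairs_seqS], the pairs [(0, t)] give the first block and the shifted pairs, which see
    only [v] and [u], give the second. *)
Lemma Xvec_cons_row (m : nat) (a b : F) (v u : 'rV[F]_m) :
  Xvec (cons_row a v) (cons_row b u) =
    join (n := m.+1) (a *: u - b *: v) (Xvec v u).
Proof.
apply/rowP => k; rewrite castmxE cast_ord_id !mxE (tnth_nth (ord0, ord0)) /=.
rewrite lex_pairs_seqS nth_cat size_map size_enum_ord.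
case: splitP => j /= ->.
  rewrite ltn_ord (nth_map j) ?size_enum_ord ?ltn_ord //= nth_ord_enum.
  by rewrite !cons_row_ord0 !cons_row_lift !mxE [v 0 j * b]mulrC.
have jm : (j < size (lex_pairs_seq m))%N by rewrite (eqP (size_lex_pairs m)).
rewrite ltnNge leq_addr /= addKn !mxE.
rewrite (nth_map (tnth (lex_pairs m) j)) //= -(tnth_nth _ (lex_pairs m)).
by rewrite !liftK.
Qed.

(** A 2-subspace through [v] has a basis [v, u], and the multiples of [Xvec v u] are the vectors
    [Xvec v (c *: u)]. *)
Lemma PV_line (m : nat) (v : 'rV[F]_m) :
  (1 < m)%N -> v != 0 -> PV <[v]>%VS = range (Xvec v).
Proof.
move=> m_gt1 v0.
have basis2 u : u \notin <[v]>%VS -> basis_of <<[:: v; u]>>%VS [:: v; u].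
  move=> uv; rewrite /basis_of eqxx /=.
  have /perm_free -> : perm_eq [:: v; u] [:: u; v].
    by rewrite (perm_catC [:: v] [:: u]).
  by rewrite free_cons span_seq1 uv seq1_free.
have mem_PV u x : u \notin <[v]>%VS -> x \in <[Xvec v u]>%VS -> PV <[v]>%VS x.
  move=> /basis2 Buv xX; exists <<[:: v; u]>>%VS => /=.
    split; last by rewrite -memvE memv_span ?mem_head.
    exact: (size_basis (X := [tuple v; u])).
  by rewrite (pluckerE Buv).
apply/seteqP; split=> x.
  case=> U [dU vU] /=.
  have /subvPn[u uU uv] : ~~ (U <= <[v]>)%VS.
    by apply/negP => /dimvS; rewrite dU dim_vline v0.
  have BU : basis_of U [:: v; u].
    rewrite basisEfree (basis_free (basis2 u uv)) dU /= andbT.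
    by rewrite span_cons span_seq1 subv_add vU -memvE.
  rewrite (pluckerE BU) => /vlineP[c ->].
  by exists (c *: u) => //; rewrite linearZ.
case=> u _ <-; have [/vlineP[c ->]|uv] := boolP (u \in <[v]>%VS); last first.
  exact: mem_PV uv (memv_line _).
(* For [u] on the line of [v] the value is 0; it lies in [PV] as soon as some 2-subspace contains
   [v], hence a [w] off the line, which [1 < m] provides. *)
have /subvPn[w _ wv] : ~~ (fullv <= <[v]>)%VS.
  have dimE : dim 'rV[F]_m = m by rewrite dim_matrix; exact: mul1n.
  by apply/negP => /dimvS; rewrite dimvf dim_vline v0 dimE leqNgt m_gt1.
by rewrite linearZ /= Xvecvv scaler0; apply: mem_PV wv (mem0v _).
Qed.

Lemma PV_limg (m : nat) (v : 'rV[F]_m) :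
  (1 < m)%N -> v != 0 -> PV <[v]>%VS = [set` limg (linfun (Xvec v))].
Proof.
move=> m_gt1 v0; rewrite PV_line //; apply/seteqP; split => x /=.
  by case=> u _ <-; rewrite -[Xvec v u](lfunE (Xvec v)) memv_img ?memvf.
by case/memv_imgP => u _ ->; exists u; rewrite ?lfunE.
Qed.

(** Its image is the graph of the linear map [a *: Xvec v]; the rows defining [U_vec v a] are the
    images of the unit vectors. *)
Definition graph_map (n : nat) (v : 'rV[F]_n.-1) (a : F) (x : 'rV[F]_n.-1) :
  'rV[F]_('C(n, 2)) := join x (a *: Xvec v x).

Lemma graph_map_is_linear (n : nat) (v : 'rV[F]_n.-1) (a : F) :
  linear (graph_map v a).
Proof.
move=> c x y; rewrite /graph_map linearP /= scalerDr scalerA [a * c]mulrC.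
by rewrite -scalerA join_linear.
Qed.

HB.instance Definition _ (n : nat) (v : 'rV[F]_n.-1) (a : F) :=
  GRing.isLinear.Build F 'rV[F]_n.-1 'rV[F]_('C(n, 2)) *:%R (graph_map v a)
    (graph_map_is_linear v a).

Lemma U_vecE (n : nat) (v : 'rV[F]_n.-1) (a : F) :
  U_vec v a = range (graph_map v a).
Proof.
rewrite /U_vec; set M := (X in rowspan X).
have -> : M = lin1_mx (graph_map v a) by apply/matrixP => i j; rewrite !mxE.
apply/seteqP; split=> x /=.
  by case/submxP => y ->; exists y; rewrite ?mul_rV_lin1.
by case=> y _ <-; rewrite /rowspan /= -mul_rV_lin1 submxMl.
Qed.

Lemma range_Xvec_cons_row_vec (m : nat) (v : 'rV[F]_m) (a : F) :
  a != 0 -> range (Xvec (cons_row a v)) = U_vec (n := m.+1) v a^-1.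
Proof.
move=> a0; rewrite U_vecE; apply/seteqP; split=> [_ [u _ <-]|_ [x _ <-]].
  rewrite -(cons_rowK u) Xvec_cons_row; set b := u 0 ord0; set u' := \row_i _.
  exists (a *: u' - b *: v) => //; rewrite /graph_map; congr join.
  rewrite linearB !linearZ /= Xvecvv oppr0 scaler0 addr0.
  by rewrite scalerA mulVf ?scale1r.
(* Adding multiples of [cons_row a v] to the preimage changes nothing, so its first coordinate can
   be taken to be 0. *)
exists (cons_row 0 (a^-1 *: x)) => //.
rewrite Xvec_cons_row scale0r subr0 scalerA divff // scale1r.
by rewrite linearZ.
Qed.

(** Since [Xvec 0] vanishes, this is the degenerate graph at [v = 0], so [range_Xvec_cons_row_vec]
    covers it too. *)
Lemma U_zeroE (m : nat) : U_zero F m.+1 = U_vec (n := m.+1) 0 1.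
Proof.
by rewrite U_vecE; apply: eq_imagel => x _; rewrite /graph_map Xvec0l scaler0.
Qed.

(** Here X_{(0,v),(b,u)} = -b (v, 0) + (0, X_{v,u}), a combination of generators. The bound [1 < m],
    that is n >= 3, allows [PV_line] for [v] itself. *)
Lemma PV_cons_row_vec0 (m : nat) (v : 'rV[F]_m) :
  (1 < m)%N -> v != 0 -> PV <[cons_row 0%R v]>%VS = U_vec0 (n := m.+1) v.
Proof.
move=> m_gt1 v0; have w0 : cons_row 0 v != 0 by rewrite cons_row_eq0 eqxx.
have mS_gt1 : (1 < m.+1)%N := ltnW m_gt1.
rewrite /U_vec0; set S := _ `|` _.
have /linspan_sub S_linspan := subvv (linspan S).
apply/seteqP; split.
  rewrite PV_line // => _ [u _ <-].
  rewrite -(cons_rowK u) Xvec_cons_row scale0r sub0r; set b := u 0 ord0.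
  set u' := \row_i _; rewrite -[Xvec v u']add0r -[- _]addr0 joinD /=.
  rewrite -scaleNr -(scaler0 _ (- b)) joinZ memvD ?memvZ //.
    by apply: S_linspan; left.
  apply: S_linspan; right; exists (Xvec v u') => //.
  by rewrite PV_line //; exists u'.
(* Seen as a [limg], the left side is a subspace, so only the generators need to be checked. *)
rewrite PV_limg //.
suff /subvP sub : (linspan S <= limg (linfun (Xvec (cons_row 0%R v))))%VS.
  by move=> x; exact: sub.
apply/linspan_sub; rewrite -PV_limg // PV_line //.
rewrite /S PV_line // => _ [->|[_ [u _ <-] <-]].
  (* The generator (v, 0) arises from b = -1 and u = 0. *)
  exists (cons_row (- 1) 0) => //.
  by rewrite Xvec_cons_row !linear0 sub0r scaleN1r opprK.
by exists (cons_row 0 u) => //; rewrite Xvec_cons_row !scale0r subr0.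
Qed.

End Plucker.

Theorem theorem17 (F : finFieldType) (n : nat) (hn : (3 <= n)%N) :
  DD F n = CC F n.
Proof.
case: n hn => // m m_gt1.
have PVE (w : 'rV[F]_m.+1) : w != 0 -> PV <[w]>%VS = range (Xvec w).
  exact/PV_line/ltnW.
have CCw (w : 'rV[F]_m.+1) : w != 0 -> CC F m.+1 (PV <[w]>%VS).
  by move=> w0; exists <[w]>%VS => //; rewrite /grassmannian /= dim_vline w0.
apply/seteqP; split=> A.
  case=> [->|[v v0 ->]|[v [a [v0 a0 ->]]]].
  - have w0 : cons_row 1 0 != 0 :> 'rV[F]_m.+1 by rewrite cons_row_eq0 oner_eq0.
    rewrite U_zeroE -invr1 -range_Xvec_cons_row_vec ?oner_eq0 // -PVE //.
    exact: CCw.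
  - by rewrite -PV_cons_row_vec0 //; apply: CCw; rewrite cons_row_eq0 eqxx.
  (* The first coordinate gets inverted by [range_Xvec_cons_row_vec], so the scalar [a] comes from
     the line of (a^-1, v). *)
  - have w0 : cons_row a^-1 v != 0 by rewrite cons_row_eq0 (negPf v0) andbF.
    rewrite -[a]invrK -range_Xvec_cons_row_vec ?invr_eq0 // -PVE //; exact: CCw.
case=> V dV <-; set w := vpick V.
have w0 : w != 0 by rewrite vpick0 -dimv_eq0 dV.
have -> : V = <[w]>%VS.
  by apply/esym/eqP; rewrite eqEdim -memvE memv_pick dV dim_vline w0.
(* The family containing [PV V] is read off from which part of the spanning vector (a, v)
   vanishes. *)
move: w0; rewrite -(cons_rowK w); set a := w 0 ord0; set v := \row_i _ => w0.
have [a0|a0] := eqVneq a 0.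
  move: w0; rewrite a0 cons_row_eq0 eqxx /= => v0.
  constructor 2; exists v => //.
  exact: PV_cons_row_vec0.
rewrite PVE // range_Xvec_cons_row_vec //.
have [->|v0] := eqVneq v 0; last first.
  by constructor 3; exists v, a^-1; rewrite invr_eq0.
(* At [v = 0] the scalars [a^-1] and 1 give the same graph. *)
constructor 1; rewrite U_zeroE !U_vecE; apply: eq_imagel => x _.
by rewrite /graph_map Xvec0l !scaler0.
Qed.
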